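(* Consider an Opportunistically Stochastic Shortest Path (OSSP) problem satisfying assumptions (A1)--(A4), (A5'), (A6) of the context. Suppose there exists $\delta\ge0$ such that, for all $x_i\in X\setminus\{t\}$, all $a\in A_i^u$, and every $r\in\{1,\dots,m\}$, $m=|\mathcal{I}(a)|$, $$C(x_i,a)\ \ge\ \sum_{j=1,\,j\ne r}^{m}\xi_jC_j+\xi_r\delta,$$ where $\mathcal{I}(a)=\{z_1,\dots,z_m\}$, $p(x_i,a,z_j)=\xi_j>0$, and each $C_j=C(x_i,e_j)$ is the cost of a deterministic action $e_j\in A_i$ transitioning to $z_j$ (i.e. $p(x_i,e_j,z_j)=1$). Then this OSSP is monotone causal, and if $\delta>0$ it is monotone $\delta$-causal.
   Context: SSP: $X=\{x_1,\dots,x_n,x_{n+1}=t\}$ is a finite set of nodes with target $t$. At node $x_i$ one chooses an action $a\in A_i=A(x_i)$, pays $C(x_i,a)$, and moves to $x_j$ with probability $p_{ij}(a)=p(x_i,a,x_j)$. The target is absorbing and free: $p(t,a,t)=1$, $C(t,a)=0$. A control mapping is $\mu:X\to\bigcup_x A(x)$ with $\mu(x)\in A(x)$; a policy is a sequence of control mappings $\pi=(\mu_0,\mu_1,\dots)$; it is stationary if all $\mu_k$ equal the same $\mu$. $\mathcal{J}(x,\pi)=\mathbb{E}[\sum_{k\ge0}C(y_k,\mu_k(y_k))\mid y_0=x]$, where $y_k$ is the state after $k$ transitions; $U(x)=\inf_\pi\mathcal{J}(x,\pi)$, $U_i=U(x_i)$, $U(t)=0$. An optimal stationary policy attains this infimum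 for every $x\in X$. Assumptions: (A1) each $A_i$ is compact; (A2) $C(x_i,\cdot)$ is lower semicontinuous on $A_i$; (A3) each $p_{ij}(\cdot)$ is continuous on $A_i$; (A4) there is a policy reaching $t$ with probability 1 from every starting node; (A5') $C(x,a)>0$ for all $x\ne t$, $a\in A(x)$; (A6) $p(x,a,x)=0$ for all $x\ne t$, $a\in A(x)$. $\mathcal{I}(a)=\{x_j\in X: p_{ij}(a)>0\}$ for $a\in A_i$; $a$ is deterministic if $\mathcal{I}(a)$ is a singleton. An SSP is an OSSP if for all $i,j$: whenever some $a\in A_i$ has $p_{ij}(a)>0$, there is $\tilde a\in A_i$ with $p_{ij}(\tilde a)=1$ (so the actions $e_j$ exist). Relaxed actions: for $a_1,\dots,a_l\in A_i$ and a probability vector $\lambda$, the relaxed action $a_\lambda$ has $p_{ij}(a_\lambda)=\sum_r\lambda_rp_{ij}(a_r)$ and $C(x_i,a_\lambda)=\sum_r\lambda_rC(x_i,a_r)$; $\Lambda(a)$ is the set of relaxed actions with the same transition probabilities as $a$ (transition-equivalent to $a$). An action $a\in A_i$ is probabilistically dominated if $C(x_i,a)>C(x_i,a_\lambda)$ for some $a_\lambda\in\Lambda(a)$; it is replaceable if there are $a_1,\dots,a_l\in A_i$, none individually having the same transition probabilities as $a$, and $\lambda$ with $a_\lambda\in\Lambda(a)$ and $C(x_i,a)=C(x_i,a_\lambda)$. $A_i^u$ is the set of useful actions: those in $A_i$ that are neither probabilistically dominated nor replaceable. An SSP is monotone causal if it has an optimal stationary policy $\mu^*$ such that for all $x_i\ne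 t$: $p_{ij}(\mu^*(x_i))>0\Rightarrow U_i>U_j$. For $\delta>0$ it is monotone $\delta$-causal if it has an optimal stationary policy $\mu^*$ such that for all $x_i\ne t$: $p_{ij}(\mu^*(x_i))>0\Rightarrow U_i\ge U_j+\delta$. *)

(* Defs.v *)
From HB Require Import structures.
From mathcomp Require Import all_boot all_order all_algebra.
From mathcomp Require Import all_classical all_reals all_analysis.

Set Implicit Arguments.
Unset Strict Implicit.
Unset Printing Implicit Defensive.

Import Order.TTheory GRing.Theory Num.Theory.
Import numFieldNormedType.Exports.

Local Open Scope classical_set_scope.
Local Open Scope ring_scope.

(* The sample space of a finite-state process started at x0. The parameter x0
   only serves to make the type pointed. *)
Definition trajectory (X : finType) (x0 : X) : Type := nat -> X.

HB.instance Definition _ (X : finType) (x0 : X) :=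
  gen_eqMixin (trajectory x0).
HB.instance Definition _ (X : finType) (x0 : X) :=
  gen_choiceMixin (trajectory x0).
HB.instance Definition _ (X : finType) (x0 : X) :=
  isPointed.Build (trajectory x0) (fun=> x0).

Definition coordinate_events (X : finType) (x0 : X) :
    set (set (trajectory x0)) :=
  [set A | exists k x, A = [set y | y k = x]].

Arguments coordinate_events {X} x0.

Notation path_space x0 := (g_sigma_algebraType (coordinate_events x0)).

(* By the pi-lambda theorem these cylinder probabilities determine P. *)
Definition is_chain_law (R : realType) (X : finType) (K : nat -> X -> X -> R)
    (x0 : X) (P : probability (path_space x0) R) : Prop :=
  forall (n : nat) (s : nat -> X),
    P [set y : path_space x0 | forall k, (k <= n)%N -> y k = s k] =
    ((s 0%N == x0)%:R * \prod_(k < n) K k (s k) (s k.+1))%:E.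

(* Existence of the law: the chain is realized on [0, 1[ with Lebesgue measure
   by successive subdivision of intervals. *)
Section chain_law_existence.
Context (R : realType) (X : finType) (x0 : X) (K : nat -> X -> X -> R).
Hypothesis K_ge0 : forall k x y, 0 <= K k x y.
Hypothesis K_sum1 : forall k x, \sum_y K k x y = 1.

Let pcdf (q : X -> R) (n : nat) : R := \sum_(i | (enum_rank i < n)%N) q i.
Let cdf q (j : X) := pcdf q (enum_rank j).

Local Lemma pcdfS q (j : X) : pcdf q (enum_rank j).+1 = cdf q j + q j.
Proof.
rewrite /pcdf (bigD1 j) ?ltnSn//= addrC; congr (_ + _).
apply: eq_bigl => i; rewrite ltnS ltn_neqAle andbC; congr (_ && _).
by rewrite (inj_eq val_inj) (inj_eq enum_rank_inj).
Qed.

Local Lemma pcdf_le q m n : (forall i, 0 <= q i) -> (m <= n)%N ->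
  pcdf q m <= pcdf q n.
Proof.
move=> q0 mn; rewrite /pcdf (big_mkcond (fun i => enum_rank i < m)%N).
rewrite (big_mkcond (fun i => enum_rank i < n)%N)/=.
apply: ler_sum => i _; case: ifPn => [im|_]; last by case: ifPn.
by rewrite (leq_trans im mn).
Qed.

Local Lemma pcdf_card q : pcdf q #|X| = \sum_i q i.
Proof. by apply: eq_bigl => i; rewrite ltn_ord. Qed.

Local Lemma pcdf0 q : pcdf q 0 = 0.
Proof. by rewrite /pcdf big_pred0. Qed.

Local Lemma cdf_pick q (v : R) : (forall i, 0 <= q i) -> \sum_i q i = 1 ->
  0 <= v < 1 -> exists j, cdf q j <= v < cdf q j + q j.
Proof.
move=> q0 q1 /andP[v0 v1].
have ex : exists n, v < pcdf q n by exists #|X|; rewrite pcdf_card q1.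
case: (ex_minnP ex) => -[|n] vn minn.
  by move: vn; rewrite pcdf0 ltNge v0.
have nX : (n < #|X|)%N by apply: minn; rewrite pcdf_card q1.
exists (enum_val (Ordinal nX)).
rewrite -pcdfS /cdf !enum_valK/= vn andbT leNgt; apply/negP => /minn.
by rewrite ltnn.
Qed.

Local Lemma cdf_uniq q (v : R) i j : (forall i, 0 <= q i) ->
  cdf q i <= v < cdf q i + q i -> cdf q j <= v < cdf q j + q j -> i = j.
Proof.
move=> q0; rewrite -!pcdfS => /andP[i1 i2] /andP[j1 j2].
apply/enum_rank_inj/val_inj/eqP; rewrite eqn_leq; apply/andP; split.
- rewrite leqNgt; apply/negP => /(pcdf_le q0) h.
  by have := lt_le_trans j2 (le_trans h i1); rewrite ltxx.
- rewrite leqNgt; apply/negP => /(pcdf_le q0) h.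
  by have := lt_le_trans i2 (le_trans h j1); rewrite ltxx.
Qed.

Let w (s : nat -> X) n : R := \prod_(k < n) K k (s k) (s k.+1).
Let lo (s : nat -> X) : nat -> R := fix F n :=
  if n is m.+1 then F m + w s m * cdf (K m (s m)) (s m.+1) else 0.
Let inI s n (u : R) := lo s n <= u < lo s n + w s n.

Local Lemma w_ge0 s n : 0 <= w s n.
Proof. exact: prodr_ge0. Qed.

Local Lemma wS s n : w s n.+1 = w s n * K n (s n) (s n.+1).
Proof. by rewrite /w big_ord_recr. Qed.

Local Lemma ext_lo s s' n : (forall k, (k <= n)%N -> s k = s' k) ->
  lo s n = lo s' n /\ w s n = w s' n.
Proof.
elim: n => [|n IH] h; first by rewrite /w !big_ord0.
have [|e1 e2] := IH; first by move=> k kn; apply: h; exact: leqW.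
by rewrite !wS /= e1 e2 !h.
Qed.

Local Lemma inI_scale s n u : 0 < w s n ->
  inI s n.+1 u = (cdf (K n (s n)) (s n.+1) <= (u - lo s n) / w s n <
   cdf (K n (s n)) (s n.+1) + K n (s n) (s n.+1)).
Proof.
move=> w0; rewrite /inI wS /= ler_pdivlMr// ltr_pdivrMr//.
rewrite lerBrDl ltrBlDl mulrDl addrA ![w s n * _]mulrC.
by [].
Qed.

Local Lemma inI_nest s n u : inI s n.+1 u -> inI s n u.
Proof.
rewrite /inI wS /= => /andP[h1 h2].
have w0 := w_ge0 s n.
have c0 : 0 <= cdf (K n (s n)) (s n.+1) by exact: sumr_ge0.
have c1 : cdf (K n (s n)) (s n.+1) + K n (s n) (s n.+1) <= 1.
  rewrite -pcdfS -(K_sum1 n (s n)) -pcdf_card.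
  by apply: pcdf_le => //; exact: ltn_ord.
apply/andP; split; first by rewrite (le_trans _ h1)// lerDl mulr_ge0.
by rewrite (lt_le_trans h2)// -addrA -mulrDr lerD2l ler_piMr.
Qed.

Local Lemma inI_le s m n u : (m <= n)%N -> inI s n u -> inI s m u.
Proof.
move=> mn; rewrite -(subnK mn); elim: (n - m)%N => // k IH.
by rewrite addSn => /inI_nest.
Qed.

Local Lemma inI_pos s n u : inI s n u -> 0 < w s n.
Proof. by move=> /andP[h1 h2]; have := le_lt_trans h1 h2; rewrite ltrDl. Qed.

Local Lemma inI_uniq s s' n u : s 0%N = s' 0%N -> inI s n u -> inI s' n u ->
  forall k, (k <= n)%N -> s k = s' k.
Proof.
move=> s0; elim: n => [|n IH] h h' k; first by rewrite leqn0 => /eqP ->.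
have {}IH := IH (inI_nest h) (inI_nest h').
rewrite leq_eqVlt => /predU1P[->|]; last by rewrite ltnS => /IH.
have e := IH n (leqnn n).
have [el ew] := ext_lo IH.
move: (h) (h'); rewrite (inI_scale _ (inI_pos (inI_nest h))).
rewrite (inI_scale _ (inI_pos (inI_nest h'))) el ew e.
exact: cdf_uniq.
Qed.

Let st (u : R) : nat -> R * R * X := fix F n :=
  if n is m.+1 then
    let: (l, v, x) := F m in
    let j := odflt x [pick j | cdf (K m x) j <= (u - l) / v <
                               cdf (K m x) j + K m x j] in
    (l + v * cdf (K m x) j, v * K m x j, j)
  else (0, 1, x0).
Let y (u : R) (n : nat) : X := if 0 <= u < 1 then (st u n).2 else x0.

Local Lemma y0 u : y u 0 = x0.
Proof. by rewrite /y; case: ifP. Qed.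

Local Lemma yP u n : 0 <= u < 1 -> inI (y u) n u.
Proof.
move=> u01; suff : inI (y u) n u /\ st u n = (lo (y u) n, w (y u) n, y u n).
  by case.
elim: n => [|n [hI hst]].
  split; last by rewrite /w big_ord0 y0.
  by rewrite /inI /w big_ord0 /= add0r.
have w0 := inI_pos hI.
have [j hj] : exists j, cdf (K n (y u n)) j <= (u - lo (y u) n) / w (y u) n <
   cdf (K n (y u n)) j + K n (y u n) j.
  apply: cdf_pick => //; move: hI => /andP[h1 h2].
  by rewrite divr_ge0 ?subr_ge0 ?w_ge0//= ltr_pdivrMr// mul1r ltrBlDl.
have eS : st u n.+1 = (lo (y u) n + w (y u) n * cdf (K n (y u n)) (y u n.+1),
   w (y u) n * K n (y u n) (y u n.+1), y u n.+1) /\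
  (cdf (K n (y u n)) (y u n.+1) <= (u - lo (y u) n) / w (y u) n <
   cdf (K n (y u n)) (y u n.+1) + K n (y u n) (y u n.+1)).
  rewrite [y u n.+1]/y u01 /= hst.
  by case: pickP => [i hi|/(_ j)]; [split|rewrite hj].
by rewrite inI_scale// wS; case: eS.
Qed.

Local Lemma y_event s n u : 0 <= u < 1 -> s 0%N = x0 ->
  (forall k, (k <= n)%N -> y u k = s k) <-> inI s n u.
Proof.
move=> u01 s0; split=> [/ext_lo[e1 e2]|hs].
  by have := yP n u01; rewrite /inI e1 e2.
by apply: (inI_uniq _ (yP n u01) hs); rewrite y0 s0.
Qed.

Let D : set R := `[0, 1[%classic.

Local Lemma inI_sub s n u : inI s n u -> 0 <= u < 1.
Proof. by move=> /(inI_le (leq0n n)); rewrite /inI /w big_ord0 /= add0r. Qed.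

Local Lemma inI_itv s n :
  [set u | inI s n u] = `[lo s n, lo s n + w s n[%classic.
Proof. by apply/seteqP; split=> u /=; rewrite in_itv. Qed.

Let yT (u : measurableTypeR R) : path_space x0 := y u.

Local Lemma measurable_yT : measurable_fun setT yT.
Proof.
apply: (@measurability _ _ _ (path_space x0) setT yT (coordinate_events x0) erefl).
move=> _ [_ [k [x ->]] <-]; rewrite setTI.
rewrite (_ : _ @^-1` _ =
  (\bigcup_(l : seq X) [set u | [&& nth x0 l k == x, nth x0 l 0 == x0 &
     inI (nth x0 l) k u]]) `|` (~` D `&` [set _ | x0 = x])); last first.
  apply/seteqP; split=> u /=.
    rewrite /yT => yx; have [u01|u01] := boolP (0 <= u < 1); last first.
      right; split; first by rewrite /D /= in_itv/=; apply/negP.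
      by rewrite -yx /y (negbTE u01).
    have [l e] : exists l, forall i, (i <= k)%N -> nth x0 l i = y u i.
      by exists (mkseq (y u) k.+1) => i ik; rewrite nth_mkseq.
    left; exists l => //=; rewrite !e// yx y0 !eqxx/=.
    by have [+ +] := ext_lo e; rewrite /inI => -> ->; exact: yP.
  case=> [[l _ /and3P[/eqP <- /eqP l0 h]]|[nD <-]].
    exact: (y_event k (inI_sub h) l0).2.
  by rewrite /yT /y ifN//; move: nD; rewrite /D /= in_itv/= => /negP.
apply: measurableU.
  apply: countable_bigcupT_measurable => // l.
  case: (nth x0 l k == x); last by rewrite [X in measurable X](_ : _ = set0)//; apply/seteqP; split.
  case: (nth x0 l 0 == x0); last by rewrite [X in measurable X](_ : _ = set0)//; apply/seteqP; split.
  by rewrite /= inI_itv; exact: measurable_itv.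
apply: measurableI; first by apply: measurableC; exact: measurable_itv.
have [->|xx0] := eqVneq x0 x.
  by rewrite [X in measurable X](_ : _ = setT)//; apply/seteqP; split.
rewrite [X in measurable X](_ : _ = set0)//; apply/seteqP; split=> // u /=.
by move/eqP; rewrite (negbTE xx0).
Qed.

Let mD : measurable (D : set (measurableTypeR R)).
Proof. exact: measurable_itv. Qed.

Let unit_measure := mrestr (@lebesgue_measure R) mD.

Let unit_measureT : unit_measure setT = 1%E.
Proof.
rewrite /unit_measure /mrestr setTI /D.
by rewrite (lebesgue_measure_itv `[0, 1[) /= lte_fin ltr01 sube0.
Qed.

#[local] HB.instance Definition _ := Measure.on unit_measure.
#[local] HB.instance Definition _ :=
  Measure_isProbability.Build _ _ _ unit_measure unit_measureT.
#[local] HB.instance Definition _ :=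
  isMeasurableFun.Build _ _ _ _ yT measurable_yT.

Lemma chain_law_exists :
  exists P : probability (path_space x0) R, is_chain_law K P.
Proof.
exists (distribution unit_measure yT) => n s.
rewrite -[LHS]/(lebesgue_measure
  (yT @^-1` [set y | forall k, (k <= n)%N -> y k = s k] `&` D)).
have [s0|s0] := eqVneq (s 0%N) x0; last first.
  rewrite mul0r (_ : _ `&` _ = set0) ?measure0//.
  apply/seteqP; split=> // u [/= + _] => /(_ 0%N (leq0n n)) e.
  by move: s0; rewrite -e /yT y0 eqxx.
rewrite mul1r -/(w s n).
rewrite (_ : _ `&` _ = `[lo s n, lo s n + w s n[%classic).
  rewrite (lebesgue_measure_itv `[_, _[) /= lte_fin.
  case: ifPn => [_|]; first by rewrite -EFinB addrAC subrr add0r.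
  by rewrite ltrDl -leNgt => w0; congr EFin; apply/le_anti; rewrite w0 w_ge0.
rewrite -inI_itv; apply/seteqP; split=> u /=.
  by rewrite /D /= in_itv/= => -[h u01]; apply/(y_event n u01 s0).
move=> h; have u01 := inI_sub h.
by split; [apply/(y_event n u01 s0)|rewrite /D/= in_itv].
Qed.

End chain_law_existence.

(* The target is one of the nodes. The admissible actions at a node form a type
   of their own, so that a control mapping is a dependent function. *)
Record ssp (R : realType) := SSP {
  node : finType;
  target : node;
  action : node -> topologicalType;
  cost : forall x, action x -> R;
  prob : forall x, action x -> node -> R;
  prob_ge0 : forall x (a : action x) z, 0 <= prob a z;
  prob_sum1 : forall x (a : action x), \sum_z prob a z = 1;
  target_absorbing : forall a : action target, prob a target = 1;
  target_free : forall a : action target, cost a = 0 }.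

Section ssp_theory.
Context (R : realType) (S : ssp R).
Implicit Types (x z : node S).

Definition control : Type := forall x, action x.

Definition policy : Type := nat -> control.

Definition stationary (mu : control) : policy := fun=> mu.

Definition policy_kernel (pi : policy) (k : nat) x z : R := prob (pi k x) z.

Lemma trajectory_law_exists (x : node S) (pi : policy) :
  exists P : probability (path_space x) R, is_chain_law (policy_kernel pi) P.
Proof.
apply: chain_law_exists => [k y z|k y]; first exact: prob_ge0.
exact: prob_sum1.
Qed.

Definition trajectory_law x (pi : policy) : probability (path_space x) R :=
  sval (cid (trajectory_law_exists x pi)).

Lemma trajectory_lawP x (pi : policy) :
  is_chain_law (policy_kernel pi) (trajectory_law x pi).
Proof. by rewrite /trajectory_law; case: cid. Qed.

Definition expected_cost x (pi : policy) : \bar R :=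
  (\int[trajectory_law x pi]_y \sum_(0 <= k <oo) (cost (pi k (y k)))%:E)%E.

Definition value x : \bar R := ereal_inf [set expected_cost x pi | pi in setT].

Definition optimal_stationary (mu : control) : Prop :=
  forall x, expected_cost x (stationary mu) = value x.

Definition compact_actions : Prop := forall x, compact [set: action x].

Definition lsc_costs : Prop :=
  forall x, lower_semicontinuous (fun a : action x => (cost a)%:E).

Definition continuous_probs : Prop :=
  forall x z, continuous (fun a : action x => prob a z).

Definition target_reachable : Prop :=
  exists pi : policy, forall x,
    trajectory_law x pi [set y | exists k, y k = target S] = 1%E.

Definition positive_costs : Prop :=
  forall x, x != target S -> forall a : action x, 0 < cost a.

Definition no_self_transitions : Prop :=
  forall x, x != target S -> forall a : action x, prob a x = 0.

Definition successors x (a : action x) : {set node S} :=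
  [set z | 0 < prob a z].

Definition opportunistic : Prop :=
  forall x z, (exists a : action x, 0 < prob a z) ->
    exists e : action x, prob e z = 1.

Definition same_transitions x (a b : action x) : Prop :=
  forall z, prob a z = prob b z.

Record relaxed_action x := RelaxedAction {
  ra_size : nat;
  ra_action : 'I_ra_size -> action x;
  ra_weight : 'I_ra_size -> R;
  ra_weight_ge0 : forall r, 0 <= ra_weight r;
  ra_weight_sum1 : \sum_r ra_weight r = 1 }.

Arguments ra_action {x} r _ : rename.
Arguments ra_weight {x} r _ : rename.

Definition relaxed_prob x (b : relaxed_action x) z : R :=
  \sum_r ra_weight b r * prob (ra_action b r) z.

Definition relaxed_cost x (b : relaxed_action x) : R :=
  \sum_r ra_weight b r * cost (ra_action b r).

Definition transition_equivalent x (a : action x) : set (relaxed_action x) :=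
  [set b | forall z, relaxed_prob b z = prob a z].

Definition dominated x (a : action x) : Prop :=
  exists b, transition_equivalent a b /\ relaxed_cost b < cost a.

Definition replaceable x (a : action x) : Prop :=
  exists b, [/\ forall r, ~ same_transitions (ra_action b r) a,
                transition_equivalent a b & cost a = relaxed_cost b].

Definition useful x (a : action x) : Prop := ~ dominated a /\ ~ replaceable a.

(* e z is a deterministic action leading to z; it matters only for the
   successors z of a. *)
Definition cost_condition (delta : R) x (a : action x) : Prop :=
  exists e : node S -> action x,
    (forall z, z \in successors a -> prob (e z) z = 1) /\
    (forall r, r \in successors a ->
       \sum_(z in successors a | z != r) prob a z * cost (e z)
         + prob a r * delta <= cost a).

Definition monotone_causal : Prop :=
  exists mu : control, optimal_stationary mu /\
    forall x, x != target S -> forall z, 0 < prob (mu x) z ->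
      (value z < value x)%E.

Definition monotone_delta_causal (delta : R) : Prop :=
  exists mu : control, optimal_stationary mu /\
    forall x, x != target S -> forall z, 0 < prob (mu x) z ->
      (value z + delta%:E <= value x)%E.

End ssp_theory.

(* Main.v *)
Require Import Defs.
From mathcomp Require Import all_boot all_order all_algebra.
From mathcomp Require Import all_classical all_reals all_analysis.
From mathcomp Require Import measurable_realfun lra.

(** Let U be the value function. Conditioning on the first transition shows
    that an action minimizing Q(a) = C(x, a) + sum_z p(a, z) U(z) satisfies
    Q(a) <= U(x): every policy costs at least Q of its first action
    ([expected_cost_first_step], [state_action_cost_le_expected_cost]). If mu
    picks such a minimizer at every node, then U dominates the costs that mu
    accumulates over any finite horizon, because U is nonnegative; letting the
    horizon grow, mu is optimal and U(x) = Q(mu(x)) ([greedy_optimal],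
    [bellman_equation]). This needs U to be finite. A policy that reaches the
    target almost surely may have infinite cost, but it yields a path of
    possible transitions to the target, and opportunism turns that path into a
    path of deterministic actions, of finite cost ([value_finite]).

    Minimizers of Q exist by compactness and semicontinuity. Among them, one
    whose transition vector has the largest Euclidean norm is useful
    ([greedy_maximal_useful]). It is not dominated, since relaxation averages
    Q. If it were replaceable, the actions that replace it would be minimizers
    too, and its transition vector would be a proper convex combination of
    vectors of no larger norm.

    Now let a be a useful minimizer at x with successor r. For every other
    successor z, minimality gives U(x) <= C(e_z) + U(z); substituting these
    bounds for U(z) in U(x) = C(a) + sum_z p(a, z) U(z) turns the cost condition
    into p(a, r) (U(x) - U(r)) >= p(a, r) delta ([cost_condition_gap],
    [causal_gap]). For positive delta this is the claim. For delta = 0 it gives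
    only U(x) >= U(r), and equality forces e_z to be a minimizer itself. Hence,
    for strict causality, mu uses a deterministic minimizer wherever there is
    one: that one decreases U by its own positive cost. Elsewhere a useful
    minimizer decreases U strictly ([causal_gap_strict]). *)

Set Implicit Arguments.
Unset Strict Implicit.
Unset Printing Implicit Defensive.

Import Order.TTheory GRing.Theory Num.Theory.
Import numFieldNormedType.Exports.

Local Open Scope classical_set_scope.
Local Open Scope ring_scope.

(** * Lower semicontinuous functions on compact sets *)

Section lower_semicontinuity.
Context (T : topologicalType) (R : realType).
Implicit Types f g : T -> R.

(** The sublevel sets {a in K | f a <= f b}, for b in K, form a filter base; by
    semicontinuity its cluster points are minimizers. *)
Lemma lower_semicontinuous_min f (K : set T) :
  compact K -> K !=set0 -> lower_semicontinuous (fun a => (f a)%:E) ->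
  exists2 a, K a & forall b, K b -> f a <= f b.
Proof.
move=> cK [k0 Kk0] lscf.
pose B b := K `&` [set a | f a <= f b].
have FB : ProperFilter (filter_from K B).
  apply: filter_from_proper => [|b Kb]; last by exists b; split=> //=.
  apply: filter_from_filter => [|a b Ka Kb]; first by exists k0.
  have [ab|ba] := leP (f a) (f b).
    by exists a => // c [Kc ca]; do !split => //; exact: le_trans ab.
  by exists b => // c [Kc cb]; do !split => //; exact: le_trans (ltW ba).
have FK : filter_from K B K by exists k0 => // c [].
have [a [Ka cla]] := cK _ FB FK.
exists a => // b Kb; rewrite leNgt; apply/negP => ba.
have [|V aV Vb] := lscf a (f b); first by rewrite lte_fin.
have [|c [[_ cb] /Vb]] := cla (B b) V _ aV; first by exists b.
by rewrite lte_fin ltNge => /negP; exact.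
Qed.

Lemma lower_semicontinuousD f g :
  lower_semicontinuous (fun a => (f a)%:E) -> continuous g ->
  lower_semicontinuous (fun a => (f a + g a)%:E).
Proof.
move=> lscf cg a r; rewrite lte_fin => rfg.
pose e := (f a + g a - r) / 2.
have e0 : 0 < e by rewrite divr_gt0// subr_gt0.
have [|V aV Vf] := lscf a (f a - e); first by rewrite lte_fin ltrBlDr ltrDl.
have [W aW Wg] : exists2 W, nbhs a W & forall b, W b -> g a - e < g b.
  exists [set b | g a - e < g b] => //.
  have ge : g a - e < g a by rewrite ltrBlDr ltrDl.
  exact: (cvgr_gt (g a) (cg a) _ ge).
exists (V `&` W); first exact: filterI.
move=> b [/Vf + /Wg]; rewrite !lte_fin /e; lra.
Qed.

Lemma closed_sublevel f r :
  lower_semicontinuous (fun a => (f a)%:E) -> closed [set a | f a <= r].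
Proof.
move=> /lower_semicontinuousP/(_ r); rewrite -closedC.
rewrite (_ : ~` _ = [set a | f a <= r])//.
by apply/seteqP; split=> a /=; rewrite lte_fin leNgt => /negP.
Qed.

End lower_semicontinuity.

(** * Coordinates of a finite-state chain *)

Section finite_state_chain.
Context (R : realType) (X : finType).
Implicit Types (K : nat -> X -> X -> R) (f : X -> R).

(** This is the expectation of f at time k for the chain started at x, computed
    by conditioning on the first transition, so that the time-inhomogeneous
    kernel is shifted at each step. *)
Fixpoint expected_at K f k x : R :=
  if k is j.+1 then
    \sum_w K 0%N x w * expected_at (fun n => K n.+1) f j w
  else f x.

Lemma expected_at_ge0 K f k x : (forall n y z, 0 <= K n y z) ->
  (forall y, 0 <= f y) -> 0 <= expected_at K f k x.
Proof.
move=> K0 f0; elim: k K K0 x => [|k IH] K K0 x //=.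
by apply: sumr_ge0 => w _; rewrite mulr_ge0// IH.
Qed.

Context (x0 : X).

Definition prefix_event (s : nat -> X) n : set (path_space x0) :=
  [set y | forall k, (k <= n)%N -> y k = s k].

Lemma measurable_coordinate k x :
  measurable [set y : path_space x0 | y k = x].
Proof. by apply: sub_sigma_algebra; exists k, x. Qed.

Lemma measurable_fun_coordinate d (T : measurableType d) (g : X -> T)
    (D : set (path_space x0)) k :
  measurable_fun D (fun y : path_space x0 => g (y k)).
Proof.
move=> mD B _; apply: measurableI => //.
rewrite (_ : _ @^-1` B =
    \bigcup_(z in [set z | B (g z)]) [set y : path_space x0 | y k = z]).
  apply: fin_bigcup_measurable => [|z _]; first exact: finite_finset.
  exact: measurable_coordinate.
apply/seteqP; split=> [y By|y [z Bz yz]]; first by exists (y k).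
by rewrite /= -yz in Bz.
Qed.

Lemma measurable_prefix_event s n : measurable (prefix_event s n).
Proof.
rewrite (_ : prefix_event s n =
    \bigcap_(k in [set k | (k <= n)%N]) [set y : path_space x0 | y k = s k]).
  apply: bigcap_measurable => [|k _]; first by exists 0%N.
  exact: measurable_coordinate.
by [].
Qed.

Lemma prefix_event_split s n :
  prefix_event s n = \big[setU/set0]_(w <- index_enum X)
    prefix_event (fun k => if k == n.+1 then w else s k) n.+1.
Proof.
rewrite -bigcup_seq; apply/seteqP; split=> [y ys|y [w _ yw] k kn].
  exists (y n.+1); first by rewrite /= mem_index_enum.
  move=> k; rewrite leq_eqVlt ltnS; case: eqVneq => [->//|_ /= kn].
  exact: ys.
by rewrite yw ?leqW// ltn_eqF.
Qed.

Section integral_split.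
Context (P : probability (path_space x0) R).
Local Open Scope ereal_scope.

Lemma integral_prefix_event (g : path_space x0 -> \bar R) s n :
  measurable_fun setT g -> (forall y, 0 <= g y) ->
  \int[P]_(y in prefix_event s n) g y =
  \sum_w \int[P]_(y in prefix_event
             (fun k => if k == n.+1 then w else s k) n.+1) g y.
Proof.
move=> mg g0; rewrite {1}prefix_event_split ge0_integral_bigsetU//.
- by move=> w; exact: measurable_prefix_event.
- exact: index_enum_uniq.
- move=> i j _ _ [y [yi yj]].
  by have := yi n.+1 (leqnn _); rewrite (yj n.+1 (leqnn _)) eqxx.
- exact: measurable_funTS.
Qed.

Lemma integral_state0 (g : path_space x0 -> \bar R) :
  measurable_fun setT g -> (forall y, 0 <= g y) ->
  \int[P]_y g y = \sum_w \int[P]_(y in prefix_event (fun=> w) 0) g y.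
Proof.
move=> mg g0.
rewrite (_ : setT = \big[setU/set0]_(w <- index_enum X)
    prefix_event (fun=> w) 0).
  rewrite ge0_integral_bigsetU//.
  - by move=> w; exact: measurable_prefix_event.
  - exact: index_enum_uniq.
  - move=> i j _ _ [y [yi yj]].
    by have := yi 0%N (leqnn _); rewrite (yj 0%N (leqnn _)).
  - exact: measurable_funTS.
rewrite -bigcup_seq; apply/seteqP; split=> // y _.
exists (y 0%N); first by rewrite /= mem_index_enum.
by move=> k; rewrite leqn0 => /eqP ->.
Qed.

End integral_split.

(** Fixing a whole prefix, rather than the current state alone, lets the
    induction on k run on cylinders, which are the only events whose
    probability the law gives directly: a cylinder is split according to its
    next coordinate. *)
Lemma integral_prefix_law K (P : probability (path_space x0) R) f k n s :
  (forall n y z, 0 <= K n y z) -> (forall y, 0 <= f y) ->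
  is_chain_law K P ->
  (\int[P]_(y in prefix_event s n) (f (y (n + k)%N))%:E)%E =
  ((s 0%N == x0)%:R * \prod_(i < n) K i (s i) (s i.+1) *
   expected_at (fun i => K (n + i)%N) f k (s n))%:E.
Proof.
move=> K0 f0 lawP; elim: k n s => [|k IH] n s.
  rewrite (eq_integral (cst (f (s n))%:E)).
    rewrite integral_cst; last exact: measurable_prefix_event.
    by rewrite [X in (_ * X)%E](lawP n s) -EFinM mulrC.
  by move=> y; rewrite inE => /(_ n (leqnn n)); rewrite addn0 /= => ->.
rewrite integral_prefix_event; last 2 first.
- exact: (measurable_fun_coordinate (fun x => (f x)%:E)).
- by move=> y; rewrite lee_fin.
under eq_bigr => w _ do rewrite -addSnnS IH.
rewrite sumEFin; congr EFin; rewrite /= mulr_sumr; apply: eq_bigr => w _.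
rewrite big_ord_recr /= eqxx ltn_eqF// addn0 !mulrA; congr (_ * _ * _ * _).
  by apply: eq_bigr => i _; rewrite eqSS !ltn_eqF// ltnS ltnW.
by congr expected_at; apply/funext => i; rewrite addSnnS.
Qed.

Lemma integral_coordinate K (P : probability (path_space x0) R) f k :
  (forall n y z, 0 <= K n y z) -> (forall y, 0 <= f y) ->
  is_chain_law K P ->
  (\int[P]_y (f (y k))%:E)%E = (expected_at K f k x0)%:E.
Proof.
move=> K0 f0 lawP; rewrite integral_state0; last 2 first.
- exact: (measurable_fun_coordinate (fun x => (f x)%:E)).
- by move=> y; rewrite lee_fin.
under eq_bigr => w _ do rewrite (integral_prefix_law k 0 _ K0 f0 lawP).
rewrite sumEFin; congr EFin.
rewrite (bigD1 x0)//= eqxx mul1r big_ord0 mul1r big1 ?addr0//.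
by move=> w /negbTE ->; rewrite !mul0r.
Qed.

Lemma probability_coordinate K (P : probability (path_space x0) R) k z :
  (forall n y w, 0 <= K n y w) -> is_chain_law K P ->
  P [set y : path_space x0 | y k = z] =
  (expected_at K (fun y => (y == z)%:R) k x0)%:E.
Proof.
move=> K0 lawP; rewrite -(integral_coordinate k K0 _ lawP)//.
transitivity
  (\int[P]_y (\1_[set y : path_space x0 | y k = z] y)%:E)%E.
  by rewrite integral_indic ?setIT//; exact: measurable_coordinate.
apply: eq_integral => y _; rewrite indicE; congr (nat_of_bool _)%:R%:E.
by apply/idP/idP; [rewrite inE => /eqP|move/eqP => h; rewrite inE].
Qed.

End finite_state_chain.

(** * Dynamic programming: finiteness and the Bellman equation *)

Section dynamic_programming.
Context (R : realType) (S : ssp R).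
Implicit Types (x z : node S) (pi : policy S) (mu : control S).

Definition tail_policy pi : policy S := fun k => pi k.+1.

Definition stage_cost pi k x : R :=
  expected_at (policy_kernel pi) (fun y => cost (pi k y)) k x.

Definition state_action_cost (u : node S -> R) x (a : action x) : R :=
  cost a + \sum_z prob a z * u z.

Definition greedy_action (u : node S -> R) x (a : action x) : Prop :=
  forall b : action x, state_action_cost u a <= state_action_cost u b.

Definition greedy (u : node S -> R) mu : Prop :=
  forall x, greedy_action u (mu x).

Lemma stage_costS pi k x :
  stage_cost pi k.+1 x =
  \sum_z prob (pi 0%N x) z * stage_cost (tail_policy pi) k z.
Proof. by []. Qed.

Lemma deterministic_prob x z (a : action x) w :
  prob a z = 1 -> prob a w = (w == z)%:R.
Proof.
move=> az; have [->//|wz] := eqVneq w z.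
have := prob_sum1 a; rewrite (bigD1 z)//= az.
move=> /(canRL (addKr _)); rewrite addNr => /eqP.
rewrite psumr_eq0 => [|i _]; last exact: prob_ge0.
by move=> /allP/(_ w (mem_index_enum _)); rewrite wz => /eqP.
Qed.

Hypothesis cost_ge0 : forall x (a : action x), 0 <= cost a.

Lemma stage_cost_ge0 pi k x : 0 <= stage_cost pi k x.
Proof. by apply: expected_at_ge0 => // n y z; exact: prob_ge0. Qed.

Lemma expected_cost_series x pi :
  (expected_cost x pi = \sum_(0 <= k <oo) (stage_cost pi k x)%:E)%E.
Proof.
rewrite /expected_cost integral_nneseries//; last 2 first.
- move=> k.
  exact: (measurable_fun_coordinate (fun y => (cost (pi k y))%:E)).
- by move=> k y _; rewrite lee_fin.
apply: eq_eseriesr => k _.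
apply: (@integral_coordinate _ _ _ _ _ (fun y => cost (pi k y))) => //.
  by move=> n y z; exact: prob_ge0.
exact: trajectory_lawP.
Qed.

Lemma expected_cost_ge0 x pi : (0 <= expected_cost x pi)%E.
Proof.
rewrite expected_cost_series; apply: nneseries_ge0 => k _ _.
by rewrite lee_fin stage_cost_ge0.
Qed.

(** Only nonnegative series are rearranged, so the identity also holds when the
    expected costs are infinite. *)
Lemma expected_cost_first_step x pi :
  (expected_cost x pi = (cost (pi 0%N x))%:E +
   \sum_z (prob (pi 0%N x) z)%:E * expected_cost z (tail_policy pi))%E.
Proof.
have c0 pi' k z : (0 <= (stage_cost pi' k z)%:E)%E.
  by rewrite lee_fin stage_cost_ge0.
rewrite expected_cost_series nneseries_recl//; congr (_ + _)%E.
rewrite -nneseries_addn//.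
under eq_eseriesr => k _ do rewrite addn1 stage_costS -sumEFin.
rewrite nneseries_sum => [|z k _]; last first.
  by rewrite lee_fin mulr_ge0 ?prob_ge0 ?stage_cost_ge0.
by apply: eq_bigr => z _; rewrite expected_cost_series -nneseriesZl.
Qed.

Lemma value_ge0 x : (0 <= value x)%E.
Proof. by apply: le_ereal_inf_tmp => _ [pi _ <-]; exact: expected_cost_ge0. Qed.

Lemma value_le_expected_cost x pi : (value x <= expected_cost x pi)%E.
Proof. by apply: ereal_inf_lbound; exists pi. Qed.

Section reachability.
Hypothesis opp : opportunistic S.
Let t := target S.

Lemma value_target mu : value t = 0%E.
Proof.
apply/le_anti; rewrite value_ge0 andbT.
apply: (le_trans (value_le_expected_cost _ (stationary mu))).
rewrite expected_cost_series eseries0// => k _ _; congr EFin.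
elim: k => [|k IH]; first exact: target_free.
rewrite stage_costS (bigD1 t)//= [X in _ * X + _]IH mulr0 add0r big1// => z zt.
by rewrite (deterministic_prob _ (target_absorbing _)) (negbTE zt) mul0r.
Qed.

(** The policy that plays the deterministic action towards z once, and then
    follows a policy of finite cost from z, has finite cost from x. The costs of
    that policy from other nodes may be infinite, but they get weight zero. *)
Lemma value_finite_of_edge x z (a : action x) (mu : control S) :
  0 < prob a z -> (value z < +oo)%E -> (value x < +oo)%E.
Proof.
move=> az /ereal_inf_lt[_ [pi _ <-] zoo].
have [e ez] : exists e : action x, prob e z = 1 by apply: opp; exists a.
pose pi' : policy S := fun k => if k is j.+1 then pi j else eqtype.dfwith mu e.
apply: le_lt_trans (value_le_expected_cost x pi') _.
rewrite expected_cost_first_step /= eqtype.dfwith_in lte_add_pinfty ?ltry//.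
apply: lte_sum_pinfty => w _; rewrite (deterministic_prob _ ez).
by have [->|_] := eqVneq w z; rewrite ?mul1e ?mul0e ?ltry.
Qed.

Lemma value_finite_of_hit pi k x :
  0 < expected_at (policy_kernel pi) (fun y => (y == t)%:R) k x ->
  (value x < +oo)%E.
Proof.
elim: k pi x => [|k IH] pi x /=.
  have [->|] := eqVneq x t; last by rewrite ltxx.
  by rewrite (value_target (pi 0%N)) ltry.
apply: contraTT => xoo; rewrite -leNgt big1// => z _.
have [pz|pz] := eqVneq (prob (pi 0%N x) z) 0.
  by rewrite {1}/policy_kernel pz mul0r.
have pz0 : 0 < prob (pi 0%N x) z by rewrite lt_def pz prob_ge0.
apply/eqP; rewrite mulf_eq0; apply/orP; right; apply: contraNT xoo => h.
apply: (value_finite_of_edge (pi 0%N) pz0).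
apply: (IH (tail_policy pi)); rewrite lt_def h.
by apply: expected_at_ge0 => // n y w; exact: prob_ge0.
Qed.

(** Were the value at x infinite, the target would have probability zero at
    every time, hence the event of ever reaching it would be null. *)
Lemma value_finite x : target_reachable S -> (value x < +oo)%E.
Proof.
move=> [pi /(_ x) hit]; apply: contrapT => xoo.
pose hits k := [set y : path_space x | y k = t].
have mhits k : measurable (hits k) by exact: measurable_coordinate.
have hitsE : [set y : path_space x | exists k, y k = t] = \bigcup_k hits k.
  by apply/seteqP; split=> [y [k yk]|y [k _ yk]]; exists k.
have hits0 k : trajectory_law x pi (hits k) = 0%E.
  rewrite (probability_coordinate k t _ (trajectory_lawP x pi)); last first.
    by move=> n y w; exact: prob_ge0.
  congr EFin; apply/eqP; apply: contra_notT xoo => h.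
  apply: (@value_finite_of_hit pi k); rewrite lt_def h.
  by apply: expected_at_ge0 => // n y w; exact: prob_ge0.
have : (trajectory_law x pi).-negligible (\bigcup_k hits k).
  apply: negligible_bigcup => k; apply/negligibleP; last exact: hits0.
  exact: mhits.
move/negligibleP => /(_ (bigcupT_measurable _ mhits)); rewrite -hitsE.
by rewrite [X in X = _]hit => /eqP; rewrite eqe oner_eq0.
Qed.

End reachability.

Section optimality.
Hypothesis value_lt_pinfty : forall x, (value x < +oo)%E.

Definition value_real x : R := fine (value x).
Local Notation U := value_real.
Local Notation Q := (state_action_cost U).

Lemma value_realE x : (U x)%:E = value x.
Proof. by rewrite fineK// ge0_fin_numE ?value_ge0. Qed.

Lemma state_action_cost_le_expected_cost x pi :
  ((Q (pi 0%N x))%:E <= expected_cost x pi)%E.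
Proof.
rewrite expected_cost_first_step EFinD leeD2l// -sumEFin.
apply: lee_sum => z _; rewrite EFinM value_realE.
by rewrite lee_pmul// ?lee_fin ?prob_ge0 ?value_ge0// value_le_expected_cost.
Qed.

Lemma greedy_le_value mu x : greedy U mu -> Q (mu x) <= U x.
Proof.
move=> gmu; rewrite -lee_fin value_realE.
apply: le_ereal_inf_tmp => _ [pi _ <-].
apply: le_trans (state_action_cost_le_expected_cost x pi).
by rewrite lee_fin; exact: gmu.
Qed.

(** After n steps U still accounts for the expected value of the state reached,
    and this remainder can be dropped because it is nonnegative. *)
Lemma partial_cost_le_value mu n x : (forall y, Q (mu y) <= U y) ->
  \sum_(k < n) stage_cost (stationary mu) k x <= U x.
Proof.
move=> Qmu; elim: n x => [|n IH] x.
  by rewrite big_ord0 -lee_fin value_realE value_ge0.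
rewrite big_ord_recl; apply: le_trans (Qmu x); rewrite lerD2l.
under eq_bigr => k _ do rewrite stage_costS.
rewrite exchange_big /=; apply: ler_sum => z _.
by rewrite -mulr_sumr ler_wpM2l ?prob_ge0.
Qed.

Lemma greedy_optimal mu : greedy U mu -> optimal_stationary mu.
Proof.
move=> gmu x; apply/le_anti; rewrite value_le_expected_cost andbT.
rewrite expected_cost_series; apply: lime_le.
  by apply: is_cvg_nneseries => k _ _; rewrite lee_fin stage_cost_ge0.
apply: nearW => n; rewrite sumEFin big_mkord -value_realE lee_fin.
by apply: partial_cost_le_value => y; exact: greedy_le_value.
Qed.

(** A greedy policy attains U at every node, so its first-step decomposition is
    the reverse of [greedy_le_value]. *)
Lemma bellman_equation mu x : greedy U mu -> U x = Q (mu x).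
Proof.
move=> gmu; apply/le_anti; rewrite greedy_le_value// andbT -lee_fin.
rewrite value_realE -(greedy_optimal gmu x) expected_cost_first_step EFinD.
rewrite leeD2l// -sumEFin; apply: lee_sum => z _.
by rewrite EFinM value_realE -(greedy_optimal gmu z).
Qed.

End optimality.
End dynamic_programming.

(** * Useful actions among the minimizers *)

Arguments ra_action {R S x} b _ : rename.
Arguments ra_weight {R S x} b _ : rename.

Section useful_actions.
Context (R : realType) (S : ssp R).
Implicit Types (x z : node S) (u : node S -> R).

Lemma relaxed_state_action_cost u x (b : relaxed_action x) :
  \sum_r ra_weight b r * state_action_cost u (ra_action b r) =
  relaxed_cost b + \sum_z relaxed_prob b z * u z.
Proof.
under eq_bigr => r _ do rewrite mulrDr mulr_sumr.
rewrite big_split /= exchange_big; congr (_ + _); apply: eq_bigr => z _.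
by rewrite mulr_suml; apply: eq_bigr => r _; rewrite mulrA.
Qed.

Lemma ra_weight_mean x (b : relaxed_action x) (c : R) :
  \sum_r ra_weight b r * c = c.
Proof. by rewrite -mulr_suml ra_weight_sum1 mul1r. Qed.

(** Relaxation averages the cost to go, so a cheaper relaxed action with the
    same transitions would have a component cheaper than the minimum. *)
Lemma greedy_not_dominated u x (a : action x) :
  greedy_action u a -> ~ dominated a.
Proof.
move=> ga [b [eqb]]; apply/negP; rewrite -leNgt.
rewrite -(lerD2r (\sum_z prob a z * u z)).
under [X in _ <= _ + X]eq_bigr => z _ do rewrite -eqb.
rewrite -relaxed_state_action_cost -[leLHS](ra_weight_mean b).
by apply: ler_sum => r _; rewrite ler_wpM2l ?ra_weight_ge0//; exact: ga.
Qed.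

(** An average that equals the minimum has only minimal terms of nonzero
    weight. *)
Lemma greedy_component u x (a : action x) (b : relaxed_action x) r :
  greedy_action u a -> transition_equivalent a b -> cost a = relaxed_cost b ->
  ra_weight b r != 0 -> greedy_action u (ra_action b r).
Proof.
move=> ga eqb eqc wr c; apply: le_trans (ga c).
have : \sum_i ra_weight b i *
    (state_action_cost u (ra_action b i) - state_action_cost u a) = 0.
  under eq_bigr => i _ do rewrite mulrBr.
  rewrite sumrB ra_weight_mean relaxed_state_action_cost -eqc.
  by under eq_bigr => z _ do rewrite eqb; rewrite subrr.
move=> /eqP; rewrite psumr_eq0 => [|i _]; last first.
  by rewrite mulr_ge0 ?ra_weight_ge0// subr_ge0.
move=> /allP/(_ r (mem_index_enum _)).
by rewrite mulf_eq0 (negbTE wr) subr_eq0 => /eqP ->.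
Qed.

Definition transition_sqnorm x (a : action x) : R := \sum_z prob a z ^+ 2.

(** The variance of the component transition vectors about their mean is the
    mean of the squared norms minus the squared norm of the mean. *)
Lemma transition_variance x (a : action x) (b : relaxed_action x) :
  transition_equivalent a b ->
  \sum_r ra_weight b r * \sum_z (prob (ra_action b r) z - prob a z) ^+ 2 =
  \sum_r ra_weight b r * transition_sqnorm (ra_action b r)
    - transition_sqnorm a.
Proof.
move=> eqb.
transitivity (\sum_r ra_weight b r * transition_sqnorm (ra_action b r)
    - \sum_r ra_weight b r *
        (\sum_z 2 * (prob (ra_action b r) z * prob a z) - transition_sqnorm a)).
  rewrite -sumrB; apply: eq_bigr => r _; rewrite -mulrBr /transition_sqnorm.
  by congr (_ * _); rewrite -!sumrB; apply: eq_bigr => z _; lra.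
congr (_ - _); under eq_bigr => r _ do rewrite mulrBr.
rewrite sumrB ra_weight_mean.
under eq_bigr => r _ do rewrite mulr_sumr.
rewrite exchange_big /= -sumrB; apply: eq_bigr => z _.
rewrite [X in X - _](_ : _ = 2 * (relaxed_prob b z * prob a z)).
  by rewrite eqb; lra.
by rewrite mulr_suml mulr_sumr; apply: eq_bigr => r _; lra.
Qed.

(** If a relaxed action replaced a, its components of nonzero weight would be
    minimizers, of squared norm at most that of a. Their variance about a would
    vanish, so they would all have the transitions of a. *)
Lemma greedy_maximal_useful u x (a : action x) :
  greedy_action u a ->
  (forall b : action x, greedy_action u b ->
     transition_sqnorm b <= transition_sqnorm a) ->
  useful a.
Proof.
move=> ga amax; split; first exact: greedy_not_dominated ga.
move=> [b [diff eqb eqc]].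
have [r wr] : exists r, ra_weight b r != 0.
  apply: contrapT => /forallNP w0; have := ra_weight_sum1 b.
  rewrite big1 => [/esym/eqP|r _]; first by rewrite oner_eq0.
  by have [//|/(w0 r)] := eqVneq (ra_weight b r) 0.
apply: (diff r) => z; apply/eqP; rewrite -subr_eq0 -sqrf_eq0.
have d0 i : 0 <= \sum_w (prob (ra_action b i) w - prob a w) ^+ 2.
  by apply: sumr_ge0 => w _; exact: sqr_ge0.
have : \sum_i ra_weight b i *
    \sum_w (prob (ra_action b i) w - prob a w) ^+ 2 == 0.
  rewrite eq_le sumr_ge0 ?andbT => [|i _]; last first.
    by rewrite mulr_ge0 ?ra_weight_ge0.
  rewrite transition_variance// subr_le0 -[leRHS](ra_weight_mean b).
  apply: ler_sum => i _; have [->|wi] := eqVneq (ra_weight b i) 0.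
    by rewrite !mul0r.
  rewrite ler_wpM2l ?ra_weight_ge0//; apply: amax.
  exact: greedy_component wi.
rewrite psumr_eq0 => [|i _]; last by rewrite mulr_ge0 ?ra_weight_ge0.
move=> /allP/(_ r (mem_index_enum _)); rewrite mulf_eq0 (negbTE wr) /=.
rewrite psumr_eq0 => [|w _]; last exact: sqr_ge0.
by move=> /allP/(_ z (mem_index_enum _)).
Qed.

Lemma exists_useful_greedy u x (a0 : action x) :
  compact [set: action x] ->
  lower_semicontinuous (fun a : action x => (cost a)%:E) ->
  (forall z, continuous (fun a : action x => prob a z)) ->
  exists a : action x, greedy_action u a /\ useful a.
Proof.
move=> cA lscC contP.
have cont_sum (I : finType) (F : I -> action x -> R) :
    (forall i, continuous (F i)) -> continuous (fun a => \sum_i F i a).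
  move=> cF; apply: (@continuous_big _ _ _ _ xpredT) => [|i _]; last exact: cF.
  exact: add_continuous.
have lscQ : lower_semicontinuous
    (fun a : action x => (state_action_cost u a)%:E).
  apply: lower_semicontinuousD => //; apply: cont_sum => z a.
  by apply: continuousM; [exact: contP|exact: cst_continuous].
have [|a1 _ a1min] := lower_semicontinuous_min cA _ lscQ; first by exists a0.
pose M := [set a : action x | state_action_cost u a <= state_action_cost u a1].
have cM : compact M.
  by apply: subclosed_compact cA _ => //; exact: closed_sublevel.
have M1 : M !=set0 by exists a1; rewrite /M /=.
(* Maximizing the squared norm over M is minimizing its opposite. *)
have lscN : lower_semicontinuous
    (fun a : action x => (0 - transition_sqnorm a)%:E).
  apply: lower_semicontinuousD => [|a].
    move=> a r r0; exists setT => //; exact: filterT.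
  apply: continuousN; apply: cont_sum => z {}a.
  by apply: continuousM; exact: contP.
have [a aM amax] := lower_semicontinuous_min cM M1 lscN.
have ga : greedy_action u a by move=> b; exact: le_trans aM (a1min b I).
exists a; split=> //; apply: (greedy_maximal_useful ga) => b gb.
by have := amax b (gb a1); rewrite !sub0r lerN2.
Qed.

End useful_actions.

(** * Decrease of the value along transitions *)

Section causality.
Context (R : realType) (S : ssp R).
Implicit Types (x z : node S) (u : node S -> R).

(** As the cost to go of the action towards z is its cost plus u z, the values
    of the successors other than r cancel from the cost to go of a, and only
    the costs of the cost condition remain. The first sum measures how far the
    deterministic actions towards those successors are from matching a. It is
    kept because its positivity gives strictness when delta is zero. *)
Lemma cost_condition_gap (delta : R) u x (a : action x)
    (e : node S -> action x) r :
  (forall z, z \in successors a -> prob (e z) z = 1) ->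
  \sum_(z in successors a | z != r) prob a z * cost (e z)
    + prob a r * delta <= cost a ->
  \sum_(z in successors a | z != r)
      prob a z * (state_action_cost u (e z) - state_action_cost u a)
    + prob a r * delta <=
  prob a r * (state_action_cost u a - u r).
Proof.
move=> eP; set Ua := state_action_cost u a => cond.
have off z : z \notin successors a -> prob a z = 0.
  by rewrite inE -leNgt => a0; apply/le_anti; rewrite a0 prob_ge0.
have split_sum (F : node S -> R) :
    \sum_(z in successors a | z != r) prob a z * F z =
    \sum_z prob a z * F z - prob a r * F r.
  rewrite [X in X - _](bigD1 r)//= [X in X - _]addrC addrK.
  rewrite [RHS](bigID (mem (successors a))) /= [X in _ + X]big1 ?addr0 => [|z /andP[_ /off ->]]; last first.
    by rewrite mul0r.
  by apply: eq_bigl => z; rewrite andbC.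
have -> : \sum_(z in successors a | z != r)
      prob a z * (state_action_cost u (e z) - Ua) =
    \sum_(z in successors a | z != r) prob a z * cost (e z)
    + \sum_(z in successors a | z != r) prob a z * (u z - Ua).
  rewrite -big_split /=; apply: eq_bigr => z /andP[za _].
  rewrite -mulrDr /state_action_cost (bigD1 z)//= eP// big1 => [|w wz].
    by congr (_ * _); lra.
  by rewrite (deterministic_prob _ (eP z za)) (negbTE wz) mul0r.
rewrite [X in _ + X + _]split_sum.
under [X in _ + (X - _)]eq_bigr do rewrite mulrBr.
rewrite sumrB -mulr_suml prob_sum1 mul1r.
have UaE : Ua = cost a + \sum_z prob a z * u z by [].
by move: cond; rewrite !mulrBr; lra.
Qed.

Definition has_deterministic_greedy u x : Prop :=
  exists2 a : action x, greedy_action u a & exists z, prob a z = 1.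

Lemma causal_gap (delta : R) u x (a : action x) z :
  greedy_action u a -> cost_condition delta a -> 0 < prob a z ->
  u z + delta <= state_action_cost u a.
Proof.
move=> ga [e [eP cond]] az.
have zs : z \in successors a by rewrite inE.
have : prob a z * delta <= prob a z * (state_action_cost u a - u z).
  apply: le_trans (cost_condition_gap u eP (cond z zs)); rewrite lerDr; apply: sumr_ge0 => w _.
  by rewrite mulr_ge0 ?prob_ge0// subr_ge0; exact: ga.
by rewrite ler_pM2l// lerBrDl.
Qed.

(** Since a is not deterministic, it has a successor w other than z; since the
    action towards w is not a minimizer, it contributes a positive term to
    [cost_condition_gap]. *)
Lemma causal_gap_strict (delta : R) u x (a : action x) z :
  0 <= delta -> greedy_action u a -> cost_condition delta a ->
  ~ has_deterministic_greedy u x -> 0 < prob a z ->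
  u z < state_action_cost u a.
Proof.
move=> delta0 ga [e [eP cond]] nodet az.
have zs : z \in successors a by rewrite inE.
have [w /andP[ws wz]] : exists w, (w \in successors a) && (w != z).
  apply: contrapT => /forallNP only; apply: nodet; exists a => //; exists z.
  have := prob_sum1 a; rewrite (bigD1 z)//= big1 ?addr0// => w wz.
  apply/le_anti; rewrite prob_ge0 andbT leNgt; apply/negP => aw.
  by apply: (only w); rewrite inE aw.
have : 0 < prob a z * (state_action_cost u a - u z).
  apply: lt_le_trans (cost_condition_gap u eP (cond z zs)).
  rewrite ltr_wpDr ?mulr_ge0 ?prob_ge0//.
  rewrite (bigD1 w) ?ws//= ltr_wpDr//.
    by apply: sumr_ge0 => i _; rewrite mulr_ge0 ?prob_ge0// subr_ge0; exact: ga.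
  rewrite mulr_gt0//; first by rewrite inE in ws.
  rewrite subr_gt0 ltNge; apply/negP => le_ew; apply: nodet.
  exists (e w); last by exists w; exact: eP.
  by move=> b; exact: le_trans le_ew (ga b).
by rewrite pmulr_rgt0// subr_gt0.
Qed.

Lemma deterministic_decrease u x (a : action x) z :
  0 < cost a -> (exists w, prob a w = 1) -> 0 < prob a z ->
  u z < state_action_cost u a.
Proof.
move=> a0 [w aw]; rewrite (deterministic_prob _ aw).
have [->|] := eqVneq z w; last by rewrite ltxx.
rewrite /state_action_cost (bigD1 w)//= aw big1 => [|i iw]; last first.
  by rewrite (deterministic_prob _ aw) (negbTE iw) mul0r.
by move=> _; lra.
Qed.

End causality.

Theorem theorem7 (R : realType) (S : ssp R)
    (A1 : compact_actions S) (A2 : lsc_costs S) (A3 : continuous_probs S)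
    (A4 : target_reachable S) (A5' : positive_costs S)
    (A6 : no_self_transitions S) (OSSP : opportunistic S)
    (delta : R) (delta_ge0 : 0 <= delta)
    (H : forall x : node S, x != target S ->
      forall a : action x, useful a -> cost_condition delta a) :
  monotone_causal S /\ (0 < delta -> monotone_delta_causal S delta).
Proof.
have cost_ge0 (x : node S) (a : action x) : 0 <= cost a.
  have [xt|xt] := eqVneq x (target S); last exact: ltW (A5' _ xt a).
  by move: a; rewrite xt => a; rewrite target_free.
have value_lt (x : node S) : (value x < +oo)%E by exact: value_finite.
pose u := @value_real R S.
have uE (x : node S) : (u x)%:E = value x by exact: value_realE.
have useful_greedy (x : node S) :
    exists a : action x, greedy_action u a /\ useful a.
  have [pi _] := A4; apply: exists_useful_greedy (pi 0%N x) (A1 x) (A2 x) _ => z.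
  exact: A3.
split.
  have causal_action (x : node S) : exists a : action x, greedy_action u a /\
      (x != target S ->
       forall z, 0 < prob a z -> u z < state_action_cost u a).
    have [[a ga aw]|nodet] := pselect (has_deterministic_greedy u x).
      exists a; split=> // xt z az; apply: deterministic_decrease => //.
      exact: A5'.
    have [a [ga ua]] := useful_greedy x; exists a; split=> // xt z az.
    exact: causal_gap_strict delta_ge0 ga (H x xt a ua) nodet az.
  pose mu : control S := fun x => sval (cid (causal_action x)).
  have muP x := svalP (cid (causal_action x)); rewrite -/(mu _) in muP.
  have gmu : greedy u mu by move=> x; have [] := muP x.
  exists mu; split=> [|x xt z muz]; first exact: greedy_optimal.
  rewrite -!uE lte_fin [ltRHS](bellman_equation _ _ _ gmu)//.
  by have [_] := muP x; apply.
move=> _; pose mu : control S := fun x => sval (cid (useful_greedy x)).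
have muP x := svalP (cid (useful_greedy x)); rewrite -/(mu _) in muP.
have gmu : greedy u mu by move=> x; have [] := muP x.
exists mu; split=> [|x xt z muz]; first exact: greedy_optimal.
rewrite -!uE -EFinD lee_fin [leRHS](bellman_equation _ _ _ gmu)//.
have [gx ux] := muP x; exact: causal_gap gx (H x xt _ ux) muz.
Qed.
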